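(* Let $m\ge 2$ and $n\ge m$ be integers, let $X_1,\ldots,X_n$ be i.i.d. random variables with values in a measurable space $\mathcal{X}$, and let $h:\mathcal{X}^m\to\mathbb{R}$ be measurable. Let $m_h=\mathrm{E}\,h(X_1,\ldots,X_m)$, let $U_n(h)$ be the U-statistic of order $m$ with kernel $h$, and let $k=\lfloor n/m\rfloor$. Let $\sigma^2=\mathrm{Var}(h(X_1,\ldots,X_m))$ and $b=\|h-m_h\|_\infty<\infty$. Then for all $t>0$, $$P(|U_n(h)-m_h|\ge t)\le 2\exp\left(-\frac{kt^2}{2(\sigma^2+bt/3)}\right),$$ and consequently, for every $\delta\in(0,1)$, with probability at least $1-\delta$, $$|U_n(h)-m_h|\le\sqrt{\frac{2\sigma^2\log(2/\delta)}{k}}+\frac{2b\log(2/\delta)}{3k}.$$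
   Context: The U-statistic of order $m$ with kernel $h$ based on $X_1,\ldots,X_n$ is $$U_n(h)=\frac{(n-m)!}{n!}\sum_{(i_1,\ldots,i_m)\in I_n^m}h(X_{i_1},\ldots,X_{i_m}),$$ where $I_n^m=\{(i_1,\ldots,i_m):1\le i_j\le n,\ i_j\ne i_l\text{ if }j\ne l\}$ is the set of all $m$-tuples of distinct integers between $1$ and $n$. The kernel $h$ is not assumed symmetric. $\|\cdot\|_\infty$ denotes the supremum norm over $\mathcal{X}^m$. *)

(* Defs.v *)
From HB Require Import structures.
From mathcomp Require Import all_boot all_order all_algebra.
From mathcomp Require Import all_classical all_reals all_analysis.

Set Implicit Arguments.
Unset Strict Implicit.
Unset Printing Implicit Defensive.

Import Order.TTheory GRing.Theory Num.Theory.
Import numFieldNormedType.Exports.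

Local Open Scope classical_set_scope.
Local Open Scope ring_scope.

Definition mutually_independent (d dX : measure_display)
    (Omega : measurableType d) (T : measurableType dX) (R : realType)
    (P : probability Omega R) (I : finType) (X : I -> {RV P >-> T}) : Prop :=
  forall (J : {set I}) (A : I -> set T),
    (forall i, i \in J -> measurable (A i)) ->
    P (\bigcap_(i in [set i | i \in J]) (X i @^-1` A i)) =
    (\prod_(i in J) P (X i @^-1` A i))%E.

Definition identically_distributed (d dX : measure_display)
    (Omega : measurableType d) (T : measurableType dX) (R : realType)
    (P : probability Omega R) (I : finType) (X : I -> {RV P >-> T}) : Prop :=
  forall (i j : I) (A : set T), measurable A ->
    distribution P (X i) A = distribution P (X j) A.

Definition iid (d dX : measure_display)
    (Omega : measurableType d) (T : measurableType dX) (R : realType)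
    (P : probability Omega R) (I : finType) (X : I -> {RV P >-> T}) : Prop :=
  mutually_independent X /\ identically_distributed X.

(* A genuine supremum over all points, not an essential supremum; it is
   +oo exactly when f is unbounded (and -oo only when T is empty). *)
Definition sup_norm (T : Type) (R : realType) (f : T -> R) : \bar R :=
  ereal_sup [set (`|f x|)%:E | x in [set: T]].

(* The index set of m-tuples of distinct indices is {i : m.-tuple 'I_n | uniq i};
   the kernel h need not be symmetric. *)
Definition U_stat (T : Type) (R : realType) (m n : nat)
    (h : m.-tuple T -> R) (x : 'I_n -> T) : R :=
  ((n - m)`!)%:R / (n`!)%:R *
    \sum_(i : m.-tuple 'I_n | uniq i) h (map_tuple x i).

(* h evaluated at the first m of the n points. *)
Definition kernel_at_first (T : Type) (R : realType) (m n : nat) (hmn : (m <= n)%N)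
    (h : m.-tuple T -> R) (x : 'I_n -> T) : R :=
  h [tuple x (widen_ord hmn j) | j < m].

(* Main.v *)
Require Import Defs.
From HB Require Import structures.
From mathcomp Require Import all_boot all_order all_algebra all_fingroup.
From mathcomp Require Import primitive_action alt ring lra.
From mathcomp Require Import all_classical all_reals all_analysis.
From mathcomp Require Import measurable_realfun.

Set Implicit Arguments.
Unset Strict Implicit.
Unset Printing Implicit Defensive.

Import Order.TTheory GRing.Theory Num.Theory.
Import numFieldNormedType.Exports.

Local Open Scope classical_set_scope.
Local Open Scope ring_scope.

(** The proof combines Hoeffding's representation of a U-statistic with
    Bernstein's exponential moment bound.

    Cut the indices into [k = n %/ m] disjoint blocks of length [m].  The
    symmetric group acts transitively on the injective [m]-tuples of indices,
    so averaging [h] over the images of one fixed block under all permutations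
    gives the U-statistic ([U_stat_perm]).  Averaging over the blocks as well,
    [U - m_h] is a mean over permutations of means of [k] terms
    [h (xi_j) - m_h], where for a given permutation the [xi_j] are i.i.d.
    because they read disjoint sets of coordinates
    ([U_stat_block_average]).  By convexity of the exponential ([expR_avg]),
    the moment generating function of [k * (U - m_h)] is at most the [k]-th
    power of that of a single [h (xi) - m_h] ([mgf_U_stat]).  The permuted
    means depend on one another, but only their individual moment generating
    functions enter.

    The factorization over blocks ([integral_prod_blocks]) has to come from
    the product rule for events, which is all that independence says.  Blocks
    are replaced one at a time: rectangles form a pi-system generating the
    sigma-algebra of tuples, so an identity between weighted integrals over
    rectangles extends to all nonnegative measurable functions of the block
    ([eq_ge0_integral_rectangles]).

    The single-block moment generating function is controlled by the pointwise
    inequality [exp x <= 1 + x + x^2 / (2 (1 - u/3))] for [|x| <= u < 3]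
    ([expR_quadratic_le], [mgf_bernstein]).  It holds for arguments of either
    sign, so Chernoff's bound applies to [U - m_h] and to its opposite, and the
    optimal parameter is given in [bernstein_exponent].  The confidence bound
    is the tail bound at the radius for which its right-hand side is at most
    [delta] ([bernstein_radius]). *)

(** * Weighted laws and the pi-system of rectangles *)

Section weighted_law.
Local Open Scope ereal_scope.
Context d1 d2 (Omega : measurableType d1) (S : measurableType d2)
  (R : realType).
Variables (mu : {measure set Omega -> \bar R}) (w : Omega -> R) (xi : Omega -> S).
Hypotheses (mw : measurable_fun [set: Omega] w) (w0 : forall x, (0 <= w x)%R).
Hypothesis mxi : measurable_fun [set: Omega] xi.

(** The image under [xi] of the measure with density [w] with respect to [mu].
    The hypotheses are arguments of the definition, so that its measure
    structure can be inferred from the term. *)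
Definition weighted_law of measurable_fun [set: Omega] w
    & (forall x, (0 <= w x)%R) & measurable_fun [set: Omega] xi :=
  fun A : set S => \int[mu]_(x in xi @^-1` A) (w x)%:E.

Local Notation nu := (weighted_law mw w0 mxi).

Let mpre A : measurable A -> measurable (xi @^-1` A).
Proof. by move=> mA; rewrite -[X in measurable X]setTI; exact: mxi. Qed.

Let weighted_law0 : nu set0 = 0.
Proof. by rewrite /weighted_law preimage_set0 integral_set0. Qed.

Let weighted_law_ge0 A : 0 <= nu A.
Proof. by apply: integral_ge0 => x _; rewrite lee_fin. Qed.

Let weighted_law_sigma_additive : semi_sigma_additive nu.
Proof.
move=> F mF tF mUF; rewrite /weighted_law preimage_bigcup.
apply: (semi_sigma_additive_nng_induced (f := EFin \o w)).
- exact/measurable_EFinP.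
- by move=> x; rewrite lee_fin.
- by move=> i; exact: mpre.
- apply/trivIsetP => i j _ _ ij.
  by rewrite -preimage_setI; move/trivIsetP : tF => ->//; rewrite preimage_set0.
- by rewrite -preimage_bigcup; exact: mpre.
Qed.

HB.instance Definition _ := isMeasure.Build _ _ _ nu
  weighted_law0 weighted_law_ge0 weighted_law_sigma_additive.

Import HBNNSimple.

(** On simple functions this is linearity; monotone convergence along
    nonnegative simple approximations of [g] gives the rest. *)
Lemma ge0_integral_weighted_law (g : S -> \bar R) :
  measurable_fun [set: S] g -> (forall y, 0 <= g y) ->
  \int[nu]_y g y = \int[mu]_x ((w x)%:E * g (xi x)).
Proof.
move=> mg g0; pose g_ := nnsfun_approx measurableT mg.
have g_ndecr y : {homo (fun n => g_ n y) : a b / (a <= b)%N >-> (a <= b)%R}.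
  by move=> a b ab; exact/lefP/nd_nnsfun_approx.
have g_cvg y : (g_ n y)%:E @[n --> \oo] --> g y.
  exact: cvg_nnsfun_approx.
have mg_xi n : measurable_fun [set: Omega] (fun x => g_ n (xi x)).
  exact: measurableT_comp.
transitivity (limn (fun n => \int[nu]_y (g_ n y)%:E)).
  rewrite -monotone_convergence//.
  - by apply: eq_integral => y _; apply/esym/cvg_lim => //; exact: g_cvg.
  - by move=> n; exact/measurable_EFinP/measurable_funP.
  - by move=> n y _; rewrite lee_fin.
  - by move=> y _ a b ab; rewrite lee_fin; exact: g_ndecr.
transitivity (limn (fun n => \int[mu]_x ((w x)%:E * (g_ n (xi x))%:E))); last first.
  rewrite -monotone_convergence//.
  - apply: eq_integral => x _; apply/cvg_lim => //.
    by apply: cvgeZl => //; exact: g_cvg.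
  - move=> n; under eq_fun do rewrite -EFinM.
    exact/measurable_EFinP/measurable_funM.
  - by move=> n x _; rewrite -EFinM lee_fin mulr_ge0.
  - by move=> x _ a b ab; rewrite -!EFinM lee_fin ler_wpM2l//; exact: g_ndecr.
congr (limn _); apply/funext => n.
have mpre_g r : measurable (xi @^-1` (g_ n @^-1` [set r])) by exact: mpre.
transitivity (\sum_(k \in range (g_ n))
    \int[mu]_x (k * (w x * \1_(xi @^-1` (g_ n @^-1` [set k])) x))%:E).
  under eq_integral do rewrite fimfunE -fsumEFin//.
  rewrite ge0_integral_fsum//; last 2 first.
  - by move=> y; exact/measurable_EFinP/measurable_funM.
  - by move=> y x _; rewrite nnfun_muleindic_ge0.
  apply: eq_fsbigr => r /[!inE] -[y _ gyr].
  rewrite integralZl_indic_nnsfun// integral_indic//= setIT.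
  under [RHS]eq_integral do rewrite EFinM.
  rewrite ge0_integralZl//; last 3 first.
  - exact/measurable_EFinP/measurable_funM.
  - by move=> x _; rewrite lee_fin mulr_ge0.
  - by rewrite lee_fin -gyr.
  congr (_ * _); rewrite /weighted_law integral_mkcond.
  by apply: eq_integral => x _; rewrite restrict_EFin patch_indic.
rewrite -ge0_integral_fsum//; last 2 first.
- move=> r; apply/measurable_EFinP/measurable_funM => //.
  exact: measurable_funM.
- move=> r x _; rewrite lee_fin indicE.
  have [/set_mem/= <-|_] := boolP (x \in _); last by rewrite !mulr0.
  by rewrite mulr1 mulr_ge0.
apply: eq_integral => x _; rewrite fsumEFin// -EFinM [in RHS]fimfunE.
by rewrite mulr_fsumr//; congr EFin; apply: eq_fsbigr => r _; rewrite mulrCA.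
Qed.

End weighted_law.

Section rectangles.
Context d (T : measurableType d) (m : nat).

Definition rectangle (B : 'I_m -> set T) : set (m.-tuple T) :=
  [set x | forall l, B l (tnth x l)].

Definition measurable_rectangles : set (set (m.-tuple T)) :=
  [set rectangle B | B in [set B | forall l, measurable (B l)]].

Lemma measurable_rectangle (B : 'I_m -> set T) :
  (forall l, measurable (B l)) -> measurable (rectangle B).
Proof.
move=> mB; rewrite (_ : rectangle B =
    \big[setI/setT]_(l < m) ((@tnth m T)^~ l @^-1` B l)).
  apply: bigsetI_measurable => l _; rewrite -[X in measurable X]setTI.
  exact: measurable_tnth.
apply/seteqP; split=> x /=; rewrite -bigcap_seq.
  by move=> Bx l _; exact: Bx.
by move=> Bx l; apply: Bx => /=; rewrite mem_index_enum.
Qed.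

Lemma setI_closed_rectangles : setI_closed measurable_rectangles.
Proof.
move=> _ _ [A mA <-] [B mB <-]; exists (fun l => A l `&` B l).
  by move=> l; exact: measurableI.
apply/seteqP; split=> x /=; first by move=> AB; split=> l; case: (AB l).
by move=> [Ax Bx] l; split; [exact: Ax|exact: Bx].
Qed.

Lemma measurable_tuple_rectangles :
  @measurable _ (m.-tuple T) = <<s measurable_rectangles >>.
Proof.
apply/seteqP; split; last first.
  apply: smallest_sub; first exact: sigma_algebra_measurable.
  by move=> _ [B mB <-]; exact: measurable_rectangle.
apply: smallest_sub; first exact: smallest_sigma_algebra.
move=> A; rewrite -bigcup_seq => -[/= l _ [Y mY <-]].
apply: sub_sigma_algebra; exists (fun j => if j == l then Y else setT).
  by move=> j; case: ifP.
rewrite setTI; apply/seteqP; split=> x /=.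
  by move=> /(_ l); rewrite eqxx.
by move=> Yx j; case: ifPn => // /eqP ->.
Qed.

(** The two weighted laws agree on a pi-system that generates the
    sigma-algebra of tuples and contains the whole space, and they are finite;
    hence they are equal, and so are their integrals.  The weights carry the
    factors of the other blocks when blocks are treated one at a time. *)
Lemma eq_ge0_integral_rectangles d' (Omega : measurableType d') (R : realType)
    (mu : {measure set Omega -> \bar R}) (w1 w2 : Omega -> R)
    (xi1 xi2 : Omega -> m.-tuple T) (g : m.-tuple T -> \bar R) :
  measurable_fun [set: Omega] w1 -> measurable_fun [set: Omega] w2 ->
  (forall x, 0 <= w1 x) -> (forall x, 0 <= w2 x) ->
  measurable_fun [set: Omega] xi1 -> measurable_fun [set: Omega] xi2 ->
  (\int[mu]_x (w1 x)%:E < +oo)%E ->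
  (forall B : 'I_m -> set T, (forall l, measurable (B l)) ->
    \int[mu]_(x in xi1 @^-1` rectangle B) (w1 x)%:E =
    \int[mu]_(x in xi2 @^-1` rectangle B) (w2 x)%:E)%E ->
  measurable_fun [set: m.-tuple T] g -> (forall y, 0 <= g y)%E ->
  (\int[mu]_x ((w1 x)%:E * g (xi1 x)) = \int[mu]_x ((w2 x)%:E * g (xi2 x)))%E.
Proof.
move=> mw1 mw2 w10 w20 mxi1 mxi2 w1oo eqrect mg g0.
rewrite -(ge0_integral_weighted_law _ mw1 w10 mxi1)//.
rewrite -(ge0_integral_weighted_law _ mw2 w20 mxi2)//.
apply: eq_measure_integral => A mA _.
apply: (measure_unique measurable_rectangles (fun=> setT)) => //.
- exact: measurable_tuple_rectangles.
- exact: setI_closed_rectangles.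
- move=> _; exists (fun=> setT) => //.
  by apply/seteqP; split.
- by rewrite bigcup_const.
- by move=> _ [B mB <-]; exact: eqrect.
Qed.

End rectangles.

(** * Factorization of expectations over disjoint blocks *)

Section subsamples.
Context (d dX : measure_display) (Omega : measurableType d)
  (T : measurableType dX) (R : realType) (P : probability Omega R)
  (n : nat) (X : 'I_n -> {RV P >-> T}).

Definition subsample m (t : m.-tuple 'I_n) (w : Omega) : m.-tuple T :=
  map_tuple (X ^~ w) t.

Lemma measurable_subsample m (t : m.-tuple 'I_n) :
  measurable_fun [set: Omega] (subsample t).
Proof.
apply/measurable_fun_tnthP => l.
rewrite (_ : _ \o _ = X (tnth t l)); first exact: measurable_funPT.
by apply/funext => w /=; rewrite tnth_map.
Qed.

Definition cylinder (D : {set 'I_n}) (A : 'I_n -> set T) : set Omega :=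
  \bigcap_(i in [set i | i \in D]) (X i @^-1` A i).

Lemma measurable_cylinder D A :
  (forall i, measurable (A i)) -> measurable (cylinder D A).
Proof.
move=> mA; apply: fin_bigcap_measurable.
  exact: finite_finset.
by move=> i _; rewrite -[X in measurable X]setTI; exact: measurable_funPT.
Qed.

(** Constrains the coordinates listed in [t] by [B] and all others by [A]; when
    [t] is duplicate-free the index picked is the only possible one. *)
Definition override m (t : m.-tuple 'I_n) (B : 'I_m -> set T)
    (A : 'I_n -> set T) : 'I_n -> set T :=
  fun i => if [pick l | tnth t l == i] is Some l then B l else A i.

Section override.
Variables (m : nat) (t : m.-tuple 'I_n) (B : 'I_m -> set T).
Variable A : 'I_n -> set T.
Hypothesis ut : uniq t.

Lemma override_in l : override t B A (tnth t l) = B l.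
Proof.
rewrite /override; case: pickP => [j /eqP|/(_ l)]; last by rewrite eqxx.
by move=> /tuple_uniqP; move=> /(_ ut) ->.
Qed.

Lemma override_notin i : i \notin t -> override t B A i = A i.
Proof.
rewrite /override; case: pickP => // l /eqP <- /negP[]; exact: mem_tnth.
Qed.

Lemma measurable_override :
  (forall l, measurable (B l)) -> (forall i, measurable (A i)) ->
  forall i, measurable (override t B A i).
Proof. by move=> mB mA i; rewrite /override; case: pickP. Qed.

Lemma cylinder_override (D : {set 'I_n}) : (forall i, i \in D -> i \notin t) ->
  cylinder (D :|: [set i in t])%SET (override t B A) =
  cylinder D A `&` (subsample t @^-1` rectangle B).
Proof.
move=> Dt; apply/seteqP; split=> w.
  move=> H; split=> [i /= iD|l].
    move: (H i); rewrite /= !inE iD => /(_ erefl).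
    by rewrite override_notin//; exact: Dt.
  move: (H (tnth t l)); rewrite /= !inE mem_tnth orbT => /(_ erefl).
  by rewrite override_in tnth_map.
move=> [H1 H2] i /=; rewrite !inE.
have [/tnthP[l ->] _|it] := boolP (i \in t).
  by rewrite override_in; have := H2 l; rewrite tnth_map.
by rewrite orbF override_notin//; exact: H1.
Qed.

End override.

Hypothesis hX : iid X.

Lemma prob_cylinder_rectangle m (t : m.-tuple 'I_n) (D : {set 'I_n}) A (B : 'I_m -> set T) :
  (forall i, measurable (A i)) -> (forall l, measurable (B l)) ->
  uniq t -> (forall i, i \in D -> i \notin t) ->
  (P (cylinder D A `&` (subsample t @^-1` rectangle B)) =
   P (cylinder D A) * \prod_(l < m) P (X (tnth t l) @^-1` B l))%E.
Proof.
move=> mA mB ut Dt; rewrite -cylinder_override//.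
have [ind _] := hX.
rewrite /cylinder !ind//; last by move=> i _; exact: measurable_override.
rewrite (eq_bigl [predU D & t]); last by move=> i; rewrite !inE.
rewrite bigU/=; last first.
  by apply/pred0P => i /=; apply/negP => /andP[/Dt/negP].
congr (_ * _)%E.
  apply: eq_bigr => i iD; rewrite override_notin//.
  exact: Dt.
rewrite -big_uniq//= big_tuple; apply: eq_bigr => l _.
by rewrite override_in.
Qed.

Lemma prob_rectangle m (t : m.-tuple 'I_n) (B : 'I_m -> set T) :
  (forall l, measurable (B l)) -> uniq t ->
  (P (subsample t @^-1` rectangle B) =
   \prod_(l < m) P (X (tnth t l) @^-1` B l))%E.
Proof.
move=> mB ut.
have := @prob_cylinder_rectangle m t finset.set0 (fun=> setT) B.
rewrite /cylinder (_ : [set i | _] = set0); last first.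
  by apply/seteqP; split=> i //=; rewrite inE.
rewrite bigcap_set0 setTI probability_setT mul1e; apply => //.
by move=> i; rewrite inE.
Qed.

(** A block that reads coordinates outside [D] is independent of any event about
    the coordinates in [D], and its law does not depend on which distinct
    coordinates it reads. *)
Lemma prob_cylinder_block m (t u : m.-tuple 'I_n) (D : {set 'I_n}) A (B : 'I_m -> set T) :
  (forall i, measurable (A i)) -> (forall l, measurable (B l)) ->
  uniq t -> uniq u -> (forall i, i \in D -> i \notin t) ->
  (P (cylinder D A `&` (subsample t @^-1` rectangle B)) =
   P (cylinder D A) * P (subsample u @^-1` rectangle B))%E.
Proof.
move=> mA mB ut uu Dt; rewrite prob_cylinder_rectangle// prob_rectangle//.
congr (_ * _)%E; apply: eq_bigr => l _.
by have [_] := hX; exact.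
Qed.

(** Keeping an event about the coordinates in [D] in the statement is what
    makes the induction on the list of blocks work.  For the first block [t],
    take all the other factors as a weight: on a rectangle the indicator of
    [t] merges with the event about [D], and the induction hypothesis applies
    to the enlarged event.  Agreement on rectangles then extends to [g]. *)
Lemma integral_prod_blocks m (u : m.-tuple 'I_n) (g : m.-tuple T -> R) (c : R) :
  uniq u -> measurable_fun [set: m.-tuple T] g -> (forall y, 0 <= g y) ->
  (\int[P]_w (g (subsample u w))%:E = c%:E)%E ->
  forall (s : seq (m.-tuple 'I_n)) (D : {set 'I_n}) (A : 'I_n -> set T),
  (forall i, measurable (A i)) ->
  uniq (flatten (map val s)) -> (forall i, i \in D -> i \notin flatten (map val s)) ->
  (\int[P]_w ((\prod_(t <- s) g (subsample t w)) * \1_(cylinder D A) w)%:E =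
   (c ^+ size s)%:E * P (cylinder D A))%E.
Proof.
move=> uu mg g0 Egu; elim=> [|t s IH] D A mA /=.
  move=> _ _; under eq_integral do rewrite big_nil mul1r.
  rewrite integral_indic//; last exact: measurable_cylinder.
  by rewrite setIT expr0 mul1e.
rewrite cat_uniq => /and3P[ut /hasPn ts us] Dts.
have Dt i : i \in D -> i \notin t.
  by move=> /Dts; rewrite mem_cat negb_or => /andP[].
have Ds i : i \in D -> i \notin flatten (map val s).
  by move=> /Dts; rewrite mem_cat negb_or => /andP[].
have c0 : 0 <= c.
  by rewrite -lee_fin -Egu; apply: integral_ge0 => w _; rewrite lee_fin.
(* [w1] gathers the other blocks and the event; [w2] is the constant that the
   induction hypothesis produces from it. *)
pose w1 w := (\prod_(t <- s) g (subsample t w)) * \1_(cylinder D A) w.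
pose w2 (w : Omega) := c ^+ size s * fine (P (cylinder D A)).
have mpre r (v : r.-tuple 'I_n) (B : 'I_r -> set T) :
    (forall l, measurable (B l)) ->
    measurable (subsample v @^-1` rectangle B).
  move=> mB; rewrite -[X in measurable X]setTI; apply: measurable_subsample => //.
  exact: measurable_rectangle.
have mw1 : measurable_fun [set: Omega] w1.
  apply: measurable_funM; last exact/measurable_indic/measurable_cylinder.
  apply: measurable_prod => v _; apply: measurableT_comp => //.
  exact: measurable_subsample.
transitivity (\int[P]_w ((w1 w)%:E * (g (subsample t w))%:E))%E.
  by apply: eq_integral => w _; rewrite /w1 big_cons -EFinM [in RHS]mulrC mulrA.
rewrite (@eq_ge0_integral_rectangles _ _ _ _ _ _ P w1 w2 _ (subsample u)
  (EFin \o g))//=; last first.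
- exact/measurable_EFinP.
- move=> B mB.
  transitivity (\int[P]_w ((\prod_(t <- s) g (subsample t w)) *
      \1_(cylinder (D :|: [set i in t])%SET (override t B A)) w)%:E)%E.
    rewrite integral_mkcond; apply: eq_integral => w _.
    rewrite restrict_EFin patch_indic /= /w1 cylinder_override// indicI/=.
    by rewrite mulrA.
  rewrite IH//; last 2 first.
  - exact: measurable_override.
  - move=> i; rewrite !inE => /orP[/Ds//|it].
    by apply/negP => /ts/negP; apply.
  rewrite cylinder_override// (prob_cylinder_block _ _ ut uu)//.
  rewrite [RHS](integral_cst P (mpre _ u B mB) 
    (c ^+ size s * fine (P (cylinder D A)))%:E).
  by rewrite /w2 EFinM fineK ?muleA// fin_num_measure//; exact: measurable_cylinder.
- rewrite IH//; apply: lte_mul_pinfty; rewrite ?lee_fin ?exprn_ge0//.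
  by rewrite ltey_eq fin_num_measure//; exact: measurable_cylinder.
- exact: measurable_subsample.
- exact: measurable_subsample.
- by move=> w; rewrite mulr_ge0 ?exprn_ge0 ?fine_ge0.
- by move=> w; rewrite mulr_ge0// prodr_ge0.
- exact: measurable_cst.
rewrite /w2 (@ge0_integralZl _ _ _ P setT measurableT 
  (fun w => (g (subsample u w))%:E))//=; last 3 first.
- apply/measurable_EFinP; apply: measurableT_comp => //.
  exact: measurable_subsample.
- by move=> w _; rewrite lee_fin.
- by rewrite lee_fin mulr_ge0 ?exprn_ge0 ?fine_ge0.
rewrite Egu EFinM fineK; last first.
  by rewrite fin_num_measure//; exact: measurable_cylinder.
by rewrite muleAC -EFinM exprSr.
Qed.

Lemma integral_prod_disjoint_blocks m (u : m.-tuple 'I_n)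
    (g : m.-tuple T -> R) (c : R) (s : seq (m.-tuple 'I_n)) :
  uniq u -> measurable_fun [set: m.-tuple T] g -> (forall y, 0 <= g y) ->
  (\int[P]_w (g (subsample u w))%:E = c%:E)%E ->
  uniq (flatten (map val s)) ->
  (\int[P]_w (\prod_(t <- s) g (subsample t w))%:E = (c ^+ size s)%:E)%E.
Proof.
move=> uu mg g0 Egu us.
have := integral_prod_blocks uu mg g0 Egu (D := finset.set0) (A := fun=> setT).
have -> : cylinder finset.set0 (fun=> setT) = setT.
  by apply/seteqP; split=> w //= _ i; rewrite /= inE.
move=> /(_ s); rewrite probability_setT mule1 => <- //.
  by under [RHS]eq_integral do rewrite indicT mulr1.
by move=> i; rewrite inE.
Qed.

End subsamples.

(** * Averages over permutations *)

Section permutation_average.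
Variables (m n : nat) (mn : (m <= n)%N).

Lemma uniq_tuple_perm (t u : m.-tuple 'I_n) : uniq t -> uniq u ->
  exists s : {perm 'I_n}, u = map_tuple s t.
Proof.
move=> ut uu.
have tr : [transitive^m Sym 'I_n, on [set: 'I_n]%SET | 'P].
  by apply: ntransitive_weak (Sym_trans 'I_n); rewrite card_ord.
have inD (v : m.-tuple 'I_n) : uniq v -> v \in dtuple_on m [set: 'I_n]%SET.
  by move=> uv; rewrite inE uv; apply/fintype.subsetP => i _; rewrite inE.
have [s _ ->] := atransP2 tr (inD _ ut) (inD _ uu).
by exists s; apply: eq_from_tnth => i; rewrite !tnth_map.
Qed.

Lemma card_uniq_ord_tuples :
  #|[pred t : m.-tuple 'I_n | uniq t]| = (n ^_ m)%N.
Proof.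
rewrite -[in RHS](card_ord n) -(card_uniq_tuples m (@predT 'I_n)) cardsE.
by apply: eq_card => t; rewrite !inE unfold_in all_predT.
Qed.

(** Double counting: the sum over permutations of a fixed injective tuple does
    not depend on the tuple, by transitivity, whereas a fixed permutation only
    permutes the injective tuples. *)
Lemma sum_perm_uniq_tuple (R : numFieldType) (F : m.-tuple 'I_n -> R)
    (t : m.-tuple 'I_n) : uniq t ->
  (n ^_ m)%:R * (\sum_(s : {perm 'I_n}) F (map_tuple s t)) =
  (n`!)%:R * \sum_(i : m.-tuple 'I_n | uniq i) F i.
Proof.
move=> ut.
have const (u : m.-tuple 'I_n) : uniq u -> \sum_(s : {perm 'I_n}) F (map_tuple s u) =
    \sum_(s : {perm 'I_n}) F (map_tuple s t).
  move=> uu; have [r ->] := uniq_tuple_perm ut uu.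
  rewrite [RHS](reindex_inj (mulgI r)); apply: eq_bigr => s _; congr F.
  by apply: eq_from_tnth => i; rewrite !tnth_map permM.
(* Both sides count the same double sum, over [u] first or over [s] first. *)
transitivity (\sum_(u : m.-tuple 'I_n | uniq u)
    \sum_(s : {perm 'I_n}) F (map_tuple s u)).
  rewrite (eq_bigr _ const) sumr_const mulr_natl.
  by rewrite -card_uniq_ord_tuples.
rewrite exchange_big/= -card_Sn -[in RHS]sum1_card natr_sum mulr_suml.
apply: eq_big => [s|s _]; first by rewrite inE.
rewrite mul1r [RHS](reindex_inj (h := map_tuple s))/=; last first.
  move=> u v /(congr1 val)/= /inj_map/val_inj; apply; exact: perm_inj.
by apply: eq_bigl => u; rewrite /= map_inj_uniq//; exact: perm_inj.
Qed.

(** A U-statistic is the average of the kernel over all permuted copies of one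
    block of distinct indices, because every injective tuple of indices is
    reached by equally many permutations. *)
Lemma U_stat_perm (T : Type) (R : realType) (h : m.-tuple T -> R)
    (x : 'I_n -> T) (t : m.-tuple 'I_n) : uniq t ->
  U_stat h x = (n`!)%:R^-1 *
    \sum_(s : {perm 'I_n}) h (map_tuple x (map_tuple s t)).
Proof.
move=> ut; rewrite /U_stat.
have ratio : (n ^_ m)%:R * ((n - m)`!)%:R = (n`!)%:R :> R.
  by rewrite -natrM ffact_fact.
have nfact : (n`!)%:R != 0 :> R by rewrite pnatr_eq0 -lt0n fact_gt0.
have mfact : (n ^_ m)%:R != 0 :> R by rewrite pnatr_eq0 -lt0n ffact_gt0.
apply: (mulfI nfact); rewrite mulrA [X in X * _]mulrC divfK// mulVKf//.
apply: (mulfI mfact).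
by rewrite (sum_perm_uniq_tuple (fun i => h (map_tuple x i)))// mulrA ratio.
Qed.

End permutation_average.

Section blocks.
Variables (m n : nat).

Lemma block_lt (j : 'I_(n %/ m)) (l : 'I_m) : (j * m + l < n)%N.
Proof.
apply: leq_trans (leq_trunc_div n m).
rewrite (@leq_trans (j.+1 * m))//; last by rewrite leq_mul2r ltn_ord orbT.
by rewrite mulSn addnC ltn_add2r.
Qed.

Definition block (j : 'I_(n %/ m)) : m.-tuple 'I_n :=
  [tuple Ordinal (block_lt j l) | l < m].

Lemma uniq_blocks : uniq (flatten [seq val (block j) | j <- enum 'I_(n %/ m)]).
Proof.
rewrite (_ : flatten _ = [seq Ordinal (block_lt j l) | j <- enum 'I_(n %/ m),
    l <- enum 'I_m]); last first.
  by congr flatten; apply: eq_map => j; rewrite /= val_ord_tuple.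
apply: allpairs_uniq; [exact: enum_uniq|exact: enum_uniq|].
move=> [j l] [j' l'] _ _ /= /(congr1 val)/= E.
have m0 : (0 < m)%N by case: m l {E j j' l'} => // -[].
congr (_, _); apply: val_inj => /=.
  have := congr1 (divn^~ m) E.
  by rewrite !divnMDl// (divn_small (ltn_ord l)) (divn_small (ltn_ord l')) !addn0.
by have := congr1 (modn^~ m) E; rewrite !modnMDl (modn_small (ltn_ord l)) (modn_small (ltn_ord l')).
Qed.

Lemma uniq_block j : uniq (block j).
Proof.
apply/tuple_uniqP => l l'; rewrite !tnth_mktuple => /(congr1 val)/= /addnI.
exact: val_inj.
Qed.

End blocks.

(** Jensen's inequality for the exponential: sum the tangent line inequality
    at the mean. *)
Lemma expR_avg (R : realType) (I : finType) (a : I -> R) : (0 < #|I|)%N ->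
  expR (#|I|%:R^-1 * \sum_i a i) <= #|I|%:R^-1 * \sum_i expR (a i).
Proof.
move=> I0; set c := _ * \sum_i a i.
have N0 : 0 < #|I|%:R :> R by rewrite ltr0n.
have : \sum_i expR c * (1 + (a i - c)) <= \sum_i expR (a i).
  apply: ler_sum => i _; rewrite -[in leRHS](subrK c (a i)) expRD mulrC.
  by rewrite ler_pM2r ?expR_gt0// expR_ge1Dx.
rewrite -mulr_sumr big_split/= sumrB !sumr_const.
rewrite -[X in _ + (_ - X)]mulr_natl /c mulVKf ?gt_eqF// subrr addr0 => le.
by rewrite ler_pdivlMl// mulrC.
Qed.

(** * Bernstein's moment generating function bound *)

Lemma fact_geq_geometric n : (2 * 3 ^ n <= n.+2`!)%N.
Proof.
elim: n => // n IH; rewrite factS expnS mulnCA.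
by apply: leq_mul.
Qed.

(** From the second order on, the exponential series is dominated by a geometric
    series of ratio [u / 3], because [(n + 2)! >= 2 * 3 ^ n]. *)
Lemma expR_quadratic_le (R : realType) (x u : R) : `|x| <= u -> u < 3 ->
  expR x <= 1 + x + x ^+ 2 / (2 * (1 - u / 3)).
Proof.
move=> xu u3; have u0 : 0 <= u := le_trans (normr_ge0 _) xu.
pose q := u / 3.
have q0 : 0 <= q by rewrite divr_ge0.
have q1 : 0 < 1 - q by rewrite subr_gt0 /q; lra.
have partial n : series (exp_coeff x) n.+2 <=
    1 + x + x ^+ 2 / 2 * \sum_(i < n) q ^+ i.
  elim: n => [|n IH].
    rewrite big_ord0 mulr0 addr0 /series /= !big_nat_recr//= big_nil.
    by rewrite /exp_coeff /= !expr0 !expr1 add0r !divr1.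
  rewrite /series /= big_nat_recr//= big_ord_recr/= mulrDr addrA lerD//.
  rewrite /exp_coeff /=.
  have F3 : 2 * 3 ^+ n <= (n.+2`!)%:R :> R.
    by rewrite -natrX -natrM ler_nat fact_geq_geometric.
  have p3 : 0 < 2 * 3 ^+ n :> R by rewrite mulr_gt0// exprn_gt0.
  have -> : x ^+ 2 / 2 * q ^+ n = x ^+ 2 * u ^+ n / (2 * 3 ^+ n).
    by rewrite /q expr_div_n mulf_div.
  apply: (@le_trans _ _ (x ^+ 2 * u ^+ n / (n.+2`!)%:R)).
    rewrite ler_wpM2r// -[n.+2]addn2 exprD mulrC ler_wpM2l ?sqr_ge0//.
    by rewrite (le_trans (ler_norm _))// normrX lerXn2r ?nnegrE.
  by rewrite ler_wpM2l ?lef_pV2 ?posrE// ?(lt_le_trans p3)// mulr_ge0 ?sqr_ge0 ?exprn_ge0.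
rewrite /expR; apply: limr_le; first exact: is_cvg_series_exp_coeff.
near=> n.
have n2 : (2 <= n)%N by near: n; exists 2.
rewrite -(subnK n2) addn2 (le_trans (partial _))// lerD2l invfM mulrA.
rewrite ler_wpM2l ?divr_ge0 ?sqr_ge0//.
rewrite -[leRHS]mul1r ler_pdivlMr//.
have -> : (\sum_(i < n - 2) q ^+ i) * (1 - q) = 1 - q ^+ (n - 2).
  by rewrite mulrC -[1 - q]opprB mulNr -subrX1 opprB.
by rewrite gerBl exprn_ge0.
Unshelve. all: by end_near.
Qed.

Lemma bounded_integrable d (Omega : measurableType d) (R : realType)
    (P : probability Omega R) (f : Omega -> R) (M : R) :
  measurable_fun [set: Omega] f -> (forall w, `|f w| <= M) ->
  P.-integrable [set: Omega] (EFin \o f).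
Proof.
move=> mf fM; apply: measurable_bounded_integrable => //.
  by rewrite -ge0_fin_numE// fin_num_measure.
exists M; split; rewrite ?num_real// => x Mx y _ /=.
exact: le_trans (fM y) (ltW Mx).
Qed.

(** Integrate [expR_quadratic_le]: the linear term vanishes, and
    [1 + y <= exp y] turns the quadratic one into the exponent. *)
Lemma mgf_bernstein d (Omega : measurableType d) (R : realType)
    (P : probability Omega R) (Z : Omega -> R) (b lam v : R) :
  measurable_fun [set: Omega] Z -> (forall w, `|Z w| <= b) ->
  (\int[P]_w (Z w)%:E = 0)%E -> (\int[P]_w (Z w ^+ 2)%:E = v%:E)%E ->
  `|lam| * b < 3 ->
  (\int[P]_w (expR (lam * Z w))%:E <=
   (expR (lam ^+ 2 * v / (2 * (1 - `|lam| * b / 3))))%:E)%E.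
Proof.
move=> mZ Zb Z0 Zv lb3; set K := lam ^+ 2 / (2 * (1 - `|lam| * b / 3)).
have K0 : 0 <= K.
  by rewrite divr_ge0 ?sqr_ge0// mulr_ge0// subr_ge0; lra.
have pw w : expR (lam * Z w) <= 1 + (lam * Z w + K * Z w ^+ 2).
  rewrite addrA (le_trans (expR_quadratic_le _ lb3))//.
    by rewrite normrM ler_wpM2l.
  by rewrite lerD2l /K exprMn mulrAC.
have mexp : measurable_fun [set: Omega] (fun w => expR (lam * Z w)).
  by apply: measurableT_comp => //; exact: measurable_funM.
have iZ : P.-integrable [set: Omega] (EFin \o Z) by exact: bounded_integrable Zb.
have mZ2 : measurable_fun [set: Omega] (fun w => Z w ^+ 2).
  exact: measurable_funX.
have iZ2 : P.-integrable [set: Omega] (EFin \o (fun w => Z w ^+ 2)).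
  apply: (@bounded_integrable _ _ _ _ _ (b ^+ 2)) => // w.
  by rewrite normrX lerXn2r// nnegrE// (le_trans _ (Zb w)).
have ilZ : P.-integrable [set: Omega] (fun w => lam%:E * (Z w)%:E)%E.
  exact: integrableZl.
have iKZ2 : P.-integrable [set: Omega] (fun w => K%:E * (Z w ^+ 2)%:E)%E.
  exact: integrableZl.
apply: (@le_trans _ _ (\int[P]_w (1%:E + (lam%:E * (Z w)%:E +
    K%:E * (Z w ^+ 2)%:E)))%E).
  apply: ge0_le_integral => //.
  - exact/measurable_EFinP.
  - under eq_fun do rewrite -!EFinM -!EFinD.
    apply/measurable_EFinP/measurable_funD => //.
    by apply: measurable_funD; exact: measurable_funM.
  - by move=> w _; rewrite -!EFinM -!EFinD lee_fin pw.
rewrite integralD//=; last 2 first.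
- exact: finite_measure_integrable_cst.
- exact: integrableD.
rewrite integralD// !integralZl// Z0 Zv mule0 add0e.
rewrite [X in (X + _)%E](_ : _ = 1%:E); last first.
  rewrite (integral_cst P measurableT 1%:E) mul1e; exact: probability_setT.
rewrite -EFinM -EFinD lee_fin (le_trans (expR_ge1Dx _))// ler_expR /K.
by rewrite mulrAC.
Qed.

(** The classical choice is [lam = t / (v + b t / 3)].  When [v = 0] it would
    give the excluded value [lam * b = 3]; but then the quadratic term is
    absent and [lam = 3 / (2 b)], half of that, already reaches the bound. *)
Lemma bernstein_exponent (R : realType) (v b t : R) :
  0 <= v -> 0 <= b -> 0 < t -> 0 < v + b * t / 3 ->
  exists2 lam : R, 0 < lam & lam * b < 3 /\
    t ^+ 2 / (2 * (v + b * t / 3)) <=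
    lam * t - lam ^+ 2 * v / (2 * (1 - lam * b / 3)).
Proof.
move=> v0 b0 t0 D0; have [veq0|vpos] := eqVneq v 0.
  rewrite veq0 add0r in D0 *.
  have bpos : 0 < b.
    by rewrite lt_neqAle b0 andbT eq_sym; apply/eqP => b00; move: D0; rewrite b00; lra.
  exists (3 / (2 * b)); first by rewrite divr_gt0// mulr_gt0.
  have -> : 3 / (2 * b) * b = 3 / 2 by field; rewrite gt_eqF.
  split; first by lra.
  rewrite mulr0 mul0r subr0 le_eqVlt; apply/orP; left; apply/eqP.
  by field; rewrite !gt_eqF.
have {vpos} vpos : 0 < v by rewrite lt_neqAle v0 eq_sym vpos.
set D := v + b * t / 3 in D0 *.
have E : 1 - t / D * b / 3 = v / D.
  have -> : v = D - b * t / 3 by rewrite /D addrK.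
  by field; rewrite gt_eqF.
exists (t / D); first by rewrite divr_gt0.
split; first by rewrite mulrAC ltr_pdivrMr// /D; lra.
rewrite E le_eqVlt; apply/orP; left; apply/eqP.
by field; rewrite !gt_eqF.
Qed.

(** * The moment generating function of a U-statistic *)

Section U_statistic.
Context (d dX : measure_display) (Omega : measurableType d)
  (T : measurableType dX) (R : realType) (P : probability Omega R)
  (m n : nat) (X : 'I_n -> {RV P >-> T}) (h : m.-tuple T -> R).
Hypotheses (mn : (m <= n)%N) (hX : iid X).
Hypothesis mh : measurable_fun [set: m.-tuple T] h.

Local Notation k := (n %/ m)%N.
Local Notation U := (fun w => U_stat h (X ^~ w)).

Lemma measurable_U_stat : measurable_fun [set: Omega] U.
Proof.
apply: measurable_funM => //; under eq_fun do rewrite -big_filter.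
apply: measurable_sum => i.
apply: measurableT_comp => //; exact: measurable_subsample.
Qed.

(** Hoeffding's representation: for each permutation [s] the inner sum runs over
    disjoint blocks of coordinates. *)
Lemma U_stat_block_average (mu : R) (w : Omega) :
  k%:R * (U w - mu) = #|{perm 'I_n}|%:R^-1 * \sum_(s : {perm 'I_n})
    \sum_(j < k) (h (subsample X (map_tuple s (block j)) w) - mu).
Proof.
have N0 : (n`!)%:R != 0 :> R by rewrite pnatr_eq0 -lt0n fact_gt0.
have -> : k%:R * (U w - mu) = \sum_(j < k) (U w - mu).
  by rewrite sumr_const card_ord mulr_natl.
rewrite exchange_big mulr_sumr; apply: eq_bigr => j _.
rewrite (U_stat_perm mn h _ (uniq_block j)) sumrB mulrBr card_Sn.
by rewrite sumr_const card_Sn -[mu *+ _]mulr_natl mulKf.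
Qed.

(** Convexity moves the average over permutations out of the exponential; each
    permutation then contributes the product of [k] independent factors
    with the law of the block [u]. *)
Lemma mgf_U_stat (u : m.-tuple 'I_n) (mu b v lam : R) :
  uniq u -> (forall y, `|h y - mu| <= b) ->
  (\int[P]_w (h (subsample X u w) - mu)%:E = 0)%E ->
  (\int[P]_w ((h (subsample X u w) - mu) ^+ 2)%:E = v%:E)%E ->
  `|lam| * b < 3 ->
  (\int[P]_w (expR (lam * (k%:R * (U w - mu))))%:E <=
   (expR (k%:R * (lam ^+ 2 * v / (2 * (1 - `|lam| * b / 3)))))%:E)%E.
Proof.
move=> uu hb h0 hv lb3; set K := lam ^+ 2 * v / _.
have N0 : (0 < #|{perm 'I_n}|)%N by rewrite card_Sn fact_gt0.
have NR : 0 < #|{perm 'I_n}|%:R :> R by rewrite ltr0n.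
pose g y := expR (lam * (h y - mu)).
have mg : measurable_fun [set: m.-tuple T] g.
  apply: measurableT_comp => //; apply: measurable_funM => //.
  exact: measurable_funB.
have mgs (t : m.-tuple 'I_n) : measurable_fun [set: Omega] (g \o subsample X t).
  by apply: measurableT_comp => //; exact: measurable_subsample.
have mZ : measurable_fun [set: Omega] (fun w => h (subsample X u w) - mu).
  apply: measurable_funB => //.
  by apply: measurableT_comp => //; exact: measurable_subsample.
have gK : (\int[P]_w (g (subsample X u w))%:E <= (expR K)%:E)%E.
  exact: (mgf_bernstein mZ (fun w => hb _) h0 hv lb3).
have g0 : (0 <= \int[P]_w (g (subsample X u w))%:E)%E.
  by apply: integral_ge0 => w _; rewrite lee_fin expR_ge0.
have [c Egc] : exists c, (\int[P]_w (g (subsample X u w))%:E = c%:E)%E.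
  exists (fine (\int[P]_w (g (subsample X u w))%:E)); rewrite fineK//.
  by rewrite ge0_fin_numE// (le_lt_trans gK)// ltry.
pose S (s : {perm 'I_n}) := [seq map_tuple s (block j) | j <- enum 'I_k].
pose G s w := \prod_(t <- S s) g (subsample X t w).
have mG s : measurable_fun [set: Omega] (G s).
  by apply: measurable_prod => t _; exact: mgs.
have G0 s w : 0 <= G s w by apply: prodr_ge0 => t _; exact: expR_ge0.
have EG s : (\int[P]_w (G s w)%:E = (c ^+ k)%:E)%E.
  rewrite (integral_prod_disjoint_blocks hX uu mg _ Egc)//.
  - by rewrite size_map size_enum_ord.
  - by move=> y; exact: expR_ge0.
  - rewrite /S -map_comp.
    rewrite (_ : [seq _ | _ <- _] = map (map s) [seq val (block j) | j <- enum 'I_k]).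
      by rewrite -map_flatten map_inj_uniq ?uniq_blocks//; exact: perm_inj.
    by rewrite -[RHS]map_comp; apply: eq_map.
have pw w : expR (lam * (k%:R * (U w - mu))) <=
    #|{perm 'I_n}|%:R^-1 * \sum_(s : {perm 'I_n}) G s w.
  rewrite U_stat_block_average mulrCA mulr_sumr.
  apply: (le_trans (expR_avg _ N0)); rewrite ler_wpM2l ?invr_ge0 ?ler0n//.
  apply: ler_sum => s _; rewrite mulr_sumr expR_sum /G /S big_map.
  by rewrite big_enum.
apply: (@le_trans _ _ (\int[P]_w ((#|{perm 'I_n}|%:R^-1)%:E *
    (\sum_(s : {perm 'I_n}) (G s w)%:E)))%E).
  apply: ge0_le_integral => //.
  - apply/measurable_EFinP; apply: measurableT_comp => //.
    do 2 apply: measurable_funM => //; apply: measurable_funB => //.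
    exact: measurable_U_stat.
  - under eq_fun do rewrite sumEFin -EFinM.
    apply/measurable_EFinP/measurable_funM => //.
    by apply: measurable_sum => s; exact: mG.
  - by move=> w _; rewrite sumEFin -EFinM lee_fin pw.
rewrite ge0_integralZl//; last 2 first.
- under eq_fun do rewrite sumEFin.
  by apply/measurable_EFinP/measurable_sum => s; exact: mG.
- by move=> w _; apply: sume_ge0 => s _; rewrite lee_fin.
rewrite ge0_integral_sum//; last 2 first.
- by move=> s; exact/measurable_EFinP.
- by move=> s w _; rewrite lee_fin.
rewrite (eq_bigr _ (fun s _ => EG s)) sumEFin sumr_const -EFinM lee_fin.
rewrite -[(c ^+ _) *+ _]mulr_natl mulKf ?gt_eqF// mulrC expRM_natr.
have c0 : 0 <= c by rewrite -lee_fin -Egc.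
by rewrite lerXn2r ?nnegrE ?expR_ge0// -lee_fin -Egc.
Qed.

End U_statistic.

(** * Two-sided tail bound *)

Lemma measurable_superlevel d (Omega : measurableType d) (R : realType)
    (f : Omega -> R) (t : R) :
  measurable_fun [set: Omega] f -> measurable [set w | (t <= f w)%R].
Proof.
move=> mf; rewrite (_ : [set w | _] = [set: Omega] `&` f @^-1` `[t, +oo[).
  exact: mf.
by apply/seteqP; split=> w /=; rewrite in_itv/= andbT => // -[].
Qed.

Lemma chernoff_bound d (Omega : measurableType d) (R : realType)
    (P : probability Omega R) (V : Omega -> R) (r t C : R) :
  measurable_fun [set: Omega] V -> 0 < r ->
  (\int[P]_w (expR (r * V w))%:E <= C%:E)%E ->
  (P [set w | (t <= V w)%R] <= (C * expR (- (r * t)))%:E)%E.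
Proof.
move=> mV r0 VC.
pose V' : {RV P >-> R} := HB.pack V (isMeasurableFun.Build _ _ _ _ _ mV).
apply: (le_trans (chernoff V' t r0)); rewrite EFinM lee_wpmul2r//.
rewrite /mmt_gen_fun unlock; apply: le_trans VC.
by under eq_integral do rewrite /= mulrC.
Qed.

Section tail.
Context (d dX : measure_display) (Omega : measurableType d)
  (T : measurableType dX) (R : realType) (P : probability Omega R)
  (m n : nat) (X : 'I_n -> {RV P >-> T}) (h : m.-tuple T -> R).
Hypotheses (m0 : (0 < m)%N) (mn : (m <= n)%N) (hX : iid X).
Hypothesis mh : measurable_fun [set: m.-tuple T] h.

Local Notation k := (n %/ m)%N%:R.
Local Notation U := (fun w => U_stat h (X ^~ w)).

(** Applying the moment bound at [lam] and [- lam] controls both tails at once: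
    the bound depends on [lam] through its absolute value only. *)
Lemma U_stat_tail (u : m.-tuple 'I_n) (mu b v t : R) :
  uniq u -> (forall y, `|h y - mu| <= b) ->
  (\int[P]_w (h (subsample X u w) - mu)%:E = 0)%E ->
  (\int[P]_w ((h (subsample X u w) - mu) ^+ 2)%:E = v%:E)%E ->
  0 <= b -> 0 < t -> 0 < v + b * t / 3 ->
  (P [set w | (t <= `|U w - mu|)%R] <=
   2%:E * (expR (- (k * t ^+ 2 / (2 * (v + b * t / 3)))))%:E)%E.
Proof.
move=> uu hb h0 hv b0 t0 D0.
have v0 : 0 <= v.
  by rewrite -lee_fin -hv; apply: integral_ge0 => w _; rewrite lee_fin sqr_ge0.
have k0 : 0 < k :> R by rewrite ltr0n divn_gt0.
have [lam lam0 [lamb opt]] := bernstein_exponent v0 b0 t0 D0.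
have mUmu : measurable_fun [set: Omega] (fun w => U w - mu).
  by apply: measurable_funB => //; exact: measurable_U_stat.
have one_sided (e : R) : `|e| = 1 ->
    (P [set w | (t <= e * (U w - mu))%R] <=
     (expR (- (k * t ^+ 2 / (2 * (v + b * t / 3)))))%:E)%E.
  move=> e1; have elam : `|e * lam| = lam by rewrite normrM e1 mul1r gtr0_norm.
  have mV : measurable_fun [set: Omega] (fun w => e * (U w - mu)).
    exact: measurable_funM.
  have lamkgt0 : 0 < lam * k by rewrite mulr_gt0.
  set K := lam ^+ 2 * v / (2 * (1 - lam * b / 3)) in opt.
  have mgf : (\int[P]_w (expR (lam * k * (e * (U w - mu))))%:E <=
      (expR (k * K))%:E)%E.
    have := @mgf_U_stat _ _ _ _ _ P _ _ X h mn hX mh u mu b v (e * lam)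
      uu hb h0 hv.
    have e2 : e ^+ 2 = 1 by rewrite -real_normK ?num_real// e1 expr1n.
    rewrite elam exprMn e2 mul1r => /(_ lamb); apply: le_trans.
    rewrite le_eqVlt; apply/orP; left; apply/eqP/eq_integral => w _.
    by congr (expR _)%:E; ring.
  apply: (le_trans (chernoff_bound t mV lamkgt0 mgf)).
  rewrite lee_fin -expRD ler_expR.
  rewrite (_ : _ + _ = - (k * (lam * t - K))); last by ring.
  by rewrite lerN2 -mulrA ler_wpM2l// ltW.
have me (e : R) : measurable [set w | (t <= e * (U w - mu))%R].
  by apply: measurable_superlevel; exact: measurable_funM.
apply: (@le_trans _ _ (P ([set w | (t <= 1 * (U w - mu))%R] `|`
    [set w | (t <= -1 * (U w - mu))%R]))).
  apply: le_measure; rewrite ?inE//.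
  - by apply: measurable_superlevel; exact: measurableT_comp.
  - exact: measurableU.
  - by move=> w /=; rewrite ler_normr => /orP[]; [left|right]; rewrite ?mul1r ?mulN1r.
apply: (le_trans (measureU2 _ _ _)) => //.
rewrite (_ : 2%:E = 1%:E + 1%:E)%E; last by rewrite -EFinD.
rewrite muleDl// mul1e; apply: leeD; apply: one_sided.
  by rewrite normr1.
by rewrite normrN normr1.
Qed.

End tail.

(** * The deviation inequality and its inversion *)

Lemma sup_norm_ub (T : Type) (R : realType) (f : T -> R) :
  (sup_norm f < +oo)%E -> forall x, `|f x| <= fine (sup_norm f).
Proof.
move=> foo x; have le : ((`|f x|)%:E <= sup_norm f)%E.
  by apply: ereal_sup_ubound; exists x.
rewrite -lee_fin fineK// fin_numElt foo andbT.
by apply: lt_le_trans le; rewrite ltNyr.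
Qed.

Lemma fine_sup_norm_ge0 (T : Type) (R : realType) (f : T -> R) :
  (sup_norm f < +oo)%E -> 0 <= fine (sup_norm f).
Proof.
move=> foo; have [[x _]|T0] := pselect (exists x : T, True).
  exact: le_trans (sup_norm_ub foo x).
rewrite /sup_norm (_ : [set _ | _ in _] = set0) ?ereal_sup0//.
by apply/seteqP; split=> // y [x _ _]; exfalso; apply: T0; exists x.
Qed.

Lemma U_stat_cst (T : Type) (R : realType) (m n : nat) (h : m.-tuple T -> R)
    (x : 'I_n -> T) (c : R) :
  (m <= n)%N -> (forall y, h y = c) -> U_stat h x = c.
Proof.
move=> mn hc; rewrite /U_stat (eq_bigr (fun=> c)) => [|i _]; last exact: hc.
rewrite sumr_const card_uniq_ord_tuples -[c *+ _]mulr_natr mulrCA mulrAC.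
rewrite -natrM mulnC ffact_fact// divff ?mulr1//.
Qed.

(** With [a] the square root and [c] the linear term, [k a^2] and [k c] are the
    two parts of the left-hand side, which equals [k (a^2 + c (a + c))]; the
    square [k (a + c)^2] exceeds it by [k a c]. *)
Lemma bernstein_radius (R : realType) (v b L k : R) :
  0 <= v -> 0 <= b -> 0 <= L -> 0 < k ->
  let t := Num.sqrt (2 * v * L / k) + 2 * b * L / (3 * k) in
  2 * (v + b * t / 3) * L <= k * t ^+ 2.
Proof.
move=> v0 b0 L0 k0 /=; set a := Num.sqrt _; set c := 2 * b * L / (3 * k).
have a0 : 0 <= a by exact: sqrtr_ge0.
have c0 : 0 <= c by rewrite divr_ge0 ?mulr_ge0// ltW.
have a2 : k * a ^+ 2 = 2 * v * L.
  rewrite sqr_sqrtr; last by rewrite divr_ge0 ?(ltW k0)// !mulr_ge0.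
  by rewrite mulrC divfK// gt_eqF.
have kc : k * c = 2 * b * L / 3 by rewrite /c; field; rewrite gt_eqF.
rewrite (_ : 2 * _ * L = k * a ^+ 2 + (a + c) * (k * c)); last first.
  by rewrite a2 kc; field.
rewrite -subr_ge0 (_ : _ - _ = k * (a * c)); last by ring.
exact: (mulr_ge0 (ltW k0) (mulr_ge0 a0 c0)).
Qed.

(* Finiteness of the sup norm makes h bounded, so the expectation and the
   variance below are finite and fine only changes their type.
   The exponent of the tail bound is a quotient of extended reals: when
   sigma2 = b = 0 (h constant) it is - (k t^2 / 0) = -oo and the bound is 0,
   whereas real division by 0 would give the vacuous bound 2. *)
Theorem corollary3p6 (d dX : measure_display)
    (Omega : measurableType d) (T : measurableType dX) (R : realType)
    (P : probability Omega R) (m n : nat) (hm : (2 <= m)%N) (hmn : (m <= n)%N)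
    (X : 'I_n -> {RV P >-> T}) (hX : iid X)
    (h : m.-tuple T -> R) (hh : measurable_fun [set: m.-tuple T] h) :
  let Y := fun w : Omega => kernel_at_first hmn h (X ^~ w) in
  let m_h : R := fine ('E_P[Y])%E in
  let sigma2 : R := fine ('V_P[Y])%E in
  let b_ext : \bar R := sup_norm (fun x => h x - m_h) in
  let b : R := fine b_ext in
  let k : R := (n %/ m)%N%:R in
  let U := fun w : Omega => U_stat h (X ^~ w) in
  (b_ext < +oo)%E ->
  (forall t : R, 0 < t ->
    (P [set w | (t <= `|U w - m_h|)%R] <=
     2%:E * expeR (- ((k * t ^+ 2)%:E / (2 * (sigma2 + b * t / 3))%:E)))%E) /\
  (forall delta : R, 0 < delta < 1 ->
    ((1 - delta)%:E <=
     P [set w | (`|U w - m_h| <=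
        Num.sqrt (2 * sigma2 * ln (2 / delta) / k)
        + 2 * b * ln (2 / delta) / (3 * k))%R])%E).
Proof.
move=> Y m_h sigma2 b_ext b k U b_fin.
have m0 : (0 < m)%N by exact: ltnW.
have hb y : `|h y - m_h| <= b := sup_norm_ub b_fin y.
have b0 : 0 <= b by exact: fine_sup_norm_ge0 b_fin.
pose u := [tuple widen_ord hmn j | j < m].
have uu : uniq u.
  apply/tuple_uniqP => i j; rewrite !tnth_mktuple => /(congr1 val)/=.
  exact: val_inj.
have YE : Y = h \o subsample X u.
  apply/funext => w; congr h; apply: eq_from_tnth => j.
  by rewrite tnth_mktuple tnth_map tnth_mktuple.
have mY : measurable_fun [set: Omega] Y.
  by rewrite YE; apply: measurableT_comp => //; exact: measurable_subsample.
have iY : P.-integrable [set: Omega] (EFin \o Y).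
  apply: (@bounded_integrable _ _ _ _ _ (b + `|m_h|)) => // w; rewrite YE/=.
  by rewrite -lerBlDr; exact: le_trans (lerB_dist _ _) (hb _).
have icst : P.-integrable [set: Omega] (EFin \o cst m_h).
  exact: finite_measure_integrable_cst.
have Ecst (c : R) : (\int[P]_w (cst c w)%:E = c%:E)%E.
  rewrite (integral_cst P measurableT c%:E) -[RHS]mule1; congr (_ * _)%E.
  exact: probability_setT.
have EY : (\int[P]_w (Y w)%:E = m_h%:E)%E.
  by rewrite /m_h unlock fineK//; exact: integrable_fin_num.
have h0 : (\int[P]_w (h (subsample X u w) - m_h)%:E = 0)%E.
  transitivity (\int[P]_w (Y w)%:E - \int[P]_w (cst m_h w)%:E)%E.
    by rewrite -integralB_EFin//; apply: eq_integral => w _; rewrite YE.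
  by rewrite EY Ecst subee.
have mZ : measurable_fun [set: Omega] (fun w => h (subsample X u w) - m_h).
  by apply: measurable_funB => //; rewrite YE in mY.
have hv : (\int[P]_w ((h (subsample X u w) - m_h) ^+ 2)%:E = sigma2%:E)%E.
  have -> : sigma2 = fine (\int[P]_w ((h (subsample X u w) - m_h) ^+ 2)%:E).
    rewrite /sigma2 /variance covariance.unlock -/m_h expectation.unlock.
    by congr fine; apply: eq_integral => w _; rewrite expr2 YE.
  rewrite fineK//; apply: integrable_fin_num => //.
  apply: (@bounded_integrable _ _ _ _ _ (b ^+ 2)).
    exact: measurable_funX.
  by move=> w; rewrite normrX lerXn2r// nnegrE.
have v0 : 0 <= sigma2.
  by rewrite -lee_fin -hv; apply: integral_ge0 => w _; rewrite lee_fin sqr_ge0.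
have k0 : 0 < k by rewrite ltr0n divn_gt0.
have U_cst : b = 0 -> forall w, U w = m_h.
  move=> bz w; apply: U_stat_cst => // y; apply/eqP.
  by rewrite -subr_eq0 -normr_le0 -bz.
have tail (t : R) : 0 < t -> 0 < sigma2 + b * t / 3 ->
    (P [set w | (t <= `|U w - m_h|)%R] <=
     2%:E * (expR (- (k * t ^+ 2 / (2 * (sigma2 + b * t / 3)))))%:E)%E.
  by move=> t0 D0; exact: (U_stat_tail m0 hmn hX hh uu hb h0 hv b0 t0 D0).
split=> [t t0|delta /andP[delta0 delta1]].
  have [D0|D0] := ltP 0 (sigma2 + b * t / 3).
    apply: (le_trans (tail t t0 D0)).
    by rewrite inver gt_eqF ?mulr_gt0.
  (* Both [sigma2] and [b] vanish: [U] is constant, so the event is empty. *)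
  have bz : b = 0.
    apply/eqP; rewrite eq_le b0 andbT leNgt; apply/negP => bpos.
    move: D0; rewrite leNgt ltr_wpDl// divr_gt0// mulr_gt0//.
  rewrite (_ : [set w | _] = set0) ?measure0.
    by rewrite mule_ge0// expeR_ge0.
  apply/seteqP; split=> w //=; rewrite U_cst// subrr normr0.
  by rewrite leNgt t0.
set L := ln (2 / delta); set t := _ + _ / _.
have L0 : 0 < L.
  rewrite ln_gt0// ltr_pdivlMr//; lra.
have t0 : 0 <= t.
  by rewrite addr_ge0 ?sqrtr_ge0// divr_ge0 ?mulr_ge0// ltW.
have mU : measurable_fun [set: Omega] (fun w => `|U w - m_h|).
  apply: measurableT_comp => //; apply: measurable_funB => //.
  exact: measurable_U_stat.
(* If [b = 0] the radius is 0, which the tail bound does not cover. *)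
have [bz|bn0] := eqVneq b 0.
  rewrite (_ : [set w | _] = setT).
    rewrite [leRHS](_ : _ = 1%:E); last exact: probability_setT.
    by rewrite lee_fin gerBl ltW.
  apply/seteqP; split=> w //= _; by rewrite U_cst// subrr normr0.
have bpos : 0 < b by rewrite lt_neqAle eq_sym bn0.
have tpos : 0 < t.
  rewrite ltr_wpDl ?sqrtr_ge0// divr_gt0// ?mulr_gt0//.
have D0 : 0 < sigma2 + b * t / 3.
  by rewrite ltr_wpDl// divr_gt0// mulr_gt0.
have Pt : (P [set w | (t <= `|U w - m_h|)%R] <= delta%:E)%E.
  apply: (le_trans (tail t tpos D0)); rewrite -EFinM lee_fin.
  have rad : L <= k * t ^+ 2 / (2 * (sigma2 + b * t / 3)).
    rewrite ler_pdivlMr ?mulr_gt0// mulrC.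
    exact: (bernstein_radius v0 b0 (ltW L0) k0).
  rewrite mulrC -ler_pdivlMr// -[leRHS]invf_div -[2 / delta]lnK; last first.
    by rewrite posrE divr_gt0.
  by rewrite -expRN ler_expR lerN2.
have mA : measurable [set w | (t <= `|U w - m_h|)%R].
  exact: measurable_superlevel.
apply: (@le_trans _ _ (P (~` [set w | (t <= `|U w - m_h|)%R]))).
  by rewrite probability_setC// EFinB leeB.
apply: le_measure; rewrite ?inE//.
- exact: measurableC.
- rewrite (_ : [set w | _] = [set w | (- t <= - `|U w - m_h|)%R]).
    by apply: measurable_superlevel; exact: measurableT_comp.
  by apply/seteqP; split=> w /=; rewrite lerN2.
- by move=> w /= /negP; rewrite -ltNge => /ltW.
Qed.
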